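(* Let $r>1$ be an integer and let $p_1=2<p_2<\cdots<p_r$ be distinct primes. Then there are positive integers $\alpha_1,\ldots,\alpha_r$ such that $p_1^{\alpha_1}\cdots p_r^{\alpha_r}$ is a covering number.
   Context: For $a\in\mathbb{Z}$ and a positive integer $n$, $a(\mathrm{mod}\ n)=\{a+nx: x\in\mathbb{Z}\}$ is the residue class with modulus $n$. A finite system of residue classes $\{a_i(\mathrm{mod}\ n_i)\}_{i=1}^k$ is a cover of $\mathbb{Z}$ if every integer lies in at least one of the classes $a_i(\mathrm{mod}\ n_i)$. A positive integer $n$ is called a covering number if there is a cover of $\mathbb{Z}$ whose moduli are all distinct, greater than one, and divisors of $n$. *)

(* Defs.v *)
From mathcomp Require Import all_boot all_order all_algebra.

Set Implicit Arguments.
Unset Strict Implicit.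
Unset Printing Implicit Defensive.

Definition in_residue_class (a : int) (n : nat) (z : int) : Prop :=
  exists x : int, z = (a + n%:Z * x)%R.

(* A finite system {a_i (mod n_i)} is the sequence of the pairs (a_i, n_i). *)
Definition is_cover (s : seq (int * nat)) : Prop :=
  (forall c, c \in s -> 0 < c.2) /\
  (forall z : int, exists2 c, c \in s & in_residue_class c.1 c.2 z).

Definition covering_number (n : nat) : Prop :=
  0 < n /\
  exists s : seq (int * nat),
    [/\ is_cover s,
        uniq [seq c.2 | c <- s]
      & forall c, c \in s -> 1 < c.2 /\ c.2 %| n].

(* Main.v *)
Require Import Defs.
From mathcomp Require Import all_boot all_order all_algebra.
From mathcomp Require Import ring.

(** For odd q > 1 the number 2^(q-1) q is already a covering number: the classes
    2^i (mod 2^(i+1)), i < q - 1, miss exactly the multiples of 2^(q-1), and such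
    a multiple 2^(q-1) y with y = i (mod q) lies in 2^(q-1) i (mod 2^i q).
    Multiples of covering numbers are covering numbers, so the remaining primes
    can be given exponent 1. *)

Import GRing.Theory.

Lemma covering_number_dvd (m n : nat) :
  0 < n -> m %| n -> covering_number m -> covering_number n.
Proof.
move=> n0 mn [_ [s [cov us sP]]]; split=> //; exists s; split=> // c cs.
by have [c1 cm] := sP c cs; split=> //; apply: dvdn_trans mn.
Qed.

(** Induction on [k]: what the first [k] classes miss is [2 ^ k * y], and the parity of [y] decides.
    Odd [y] gives the class [2 ^ k] modulo [2 ^ k.+1], even [y] a multiple of [2 ^ k.+1]. *)
Lemma pow2_classes (k : nat) (z : int) :
  (exists y : int, z = (2 ^ k)%:Z * y)%R \/
  exists2 i, i < k & in_residue_class (Posz (2 ^ i)) (2 ^ i.+1) z.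
Proof.
elim: k => [|k [[y ->]|[i ik zi]]]; first by left; exists z; rewrite mul1r.
- have yE : (y = (y %% 2)%Z + 2%:Z * (y %/ 2)%Z)%R.
    by rewrite {1}(divz_eq y 2) addrC mulrC.
  have : ((y %% 2)%Z = 0 \/ (y %% 2)%Z = 1)%R.
    have := modz_ge0 y (isT : (2 : int) != 0)%R.
    have := ltz_pmod y (isT : (0 < (2 : int))%R).
    by case: (y %% 2)%Z => [[|[|m]]|m] // _ _; [left|right].
  case=> y2; rewrite yE y2.
  + by left; exists (y %/ 2)%Z; rewrite expnS PoszM; ring.
  + by right; exists k => //; exists (y %/ 2)%Z; rewrite expnS PoszM; ring.
- by right; exists i => //; apply: ltnW.
Qed.

Lemma covering_number_pow2_odd (q : nat) :
  1 < q -> odd q -> covering_number (2 ^ q.-1 * q).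
Proof.
move=> q1 oq; have q0 : 0 < q by apply: ltnW.
split; first by rewrite muln_gt0 expn_gt0.
pose f i : int * nat := (Posz (2 ^ i), 2 ^ i.+1).
(* One class for each residue [i] modulo [q]. As [i] goes up to [q - 1], the modulus needs the power
   of 2 up to exponent [q - 1], whence that exponent in the statement. *)
pose g i : int * nat := (Posz (2 ^ q.-1 * i), 2 ^ i * q).
exists (map f (iota 0 q.-1) ++ map g (iota 0 q)); split.
- split=> [c|z].
    by rewrite mem_cat => /orP[] /mapP[i _ ->] /=; rewrite ?muln_gt0 expn_gt0.
  have [[y ->]|[i ik zi]] := pow2_classes q.-1 z; last first.
    exists (f i) => //; rewrite mem_cat; apply/orP; left.
    by apply: map_f; rewrite mem_iota.
  have [i yi iq] : exists2 i : nat, (y %% q)%Z = i & i < q.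
    have := modz_ge0 y (_ : (q%:Z != 0)%R); rewrite eqz_nat -lt0n => /(_ q0).
    have := ltz_pmod y (_ : (0 < q%:Z)%R); rewrite ltz_nat => /(_ q0).
    by case: (y %% q)%Z => // i iq _; exists i.
  exists (g i).
    by rewrite mem_cat; apply/orP; right; apply: map_f; rewrite mem_iota.
  (* With [y = i + q t], the term [2 ^ (q - 1) * q t] equals [2 ^ i * q] times
     [2 ^ (q - 1 - i) * t]. *)
  exists ((2 ^ (q.-1 - i))%:Z * (y %/ q)%Z)%R => /=.
  have -> : 2 ^ q.-1 = 2 ^ i * 2 ^ (q.-1 - i).
    by rewrite -expnD subnKC // -ltnS prednK.
  by rewrite {1}(divz_eq y q) yi !PoszM; ring.
- rewrite map_cat -!map_comp cat_uniq; apply/and3P; split.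
  + by rewrite map_inj_uniq ?iota_uniq // => i j /= /(@expnI 2 isT) [].
  (* No modulus is shared by the two families: [2 ^ j * q = 2 ^ i.+1] would make [q] a divisor of a
     power of 2 coprime to it, so [q = 1]. *)
  + apply/hasPn => _ /mapP[j _ ->]; apply/mapP => -[i _] /= e.
    have : coprime q (2 ^ i.+1) by rewrite coprimeXr // coprimen2.
    by rewrite -e /coprime gcdnMl => /eqP qE; rewrite qE in q1.
  + rewrite map_inj_uniq ?iota_uniq // => i j /= /eqP.
    by rewrite eqn_pmul2r // => /eqP /(@expnI 2 isT).
- move=> c; rewrite mem_cat => /orP[] /mapP[i]; rewrite mem_iota => /= iq -> /=.
    by rewrite -{1}(expn0 2) ltn_exp2l //; split=> //; rewrite dvdn_mulr // dvdn_exp2l.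
  split; first by apply: leq_trans q1 _; rewrite leq_pmull // expn_gt0.
  by rewrite dvdn_mul // dvdn_exp2l // -ltnS prednK.
Qed.

Theorem corollary1p1 (r : nat) (hr : 1 < r) (p : 'I_r -> nat)
    (p_prime : forall i : 'I_r, prime (p i))
    (p_first : p (Ordinal (ltnW hr)) = 2)
    (p_incr : forall i j : 'I_r, i < j -> p i < p j) :
  exists alpha : 'I_r -> nat,
    (forall i : 'I_r, 0 < alpha i) /\
    covering_number (\prod_(i < r) p i ^ alpha i).
Proof.
(* The odd number [q] is the second prime, which exists because [r > 1]. *)
pose i0 := Ordinal (ltnW hr); pose i1 := Ordinal hr; pose q := p i1.
have q2 : 2 < q by rewrite -p_first; apply: p_incr.
have oq : odd q by case: (even_prime (p_prime i1)) q2 => //; rewrite -/q => ->.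
pose alpha (i : 'I_r) := if i == i0 then q.-1 else 1.
exists alpha; split=> [i|].
  by rewrite /alpha; case: ifP => // _; rewrite -ltnS prednK // (ltn_trans _ q2).
apply: (covering_number_dvd _ _ _ _ (covering_number_pow2_odd _ (ltnW q2) oq)).
  by rewrite prodn_gt0 // => i; rewrite expn_gt0 prime_gt0.
(* Splitting off the two smallest primes exhibits the factor [2 ^ q.-1 * q]. *)
rewrite (bigD1 i0) //= (bigD1 i1) //= /alpha eqxx /= p_first expn1 mulnA.
exact: dvdn_mulr.
Qed.
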